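(* Let $\mathcal{H},\mathcal{K}$ be Hilbert spaces, and let $S$ and $T$ be densely defined linear operators acting between $\mathcal{H}$ and $\mathcal{K}$, respectively between $\mathcal{K}$ and $\mathcal{H}$. The following statements are equivalent: (i) $S$ is closable and $\bar S=T^*$; (ii) (a) $S\wedge T$; (b) $-\lambda^2\notin\sigma_p(S^*T^* )$ for a certain (and also for all) $\lambda\in\mathbb{R}$, $\lambda\neq0$; (iii) (a) $S\wedge T$; (b) $-\lambda^2\notin\sigma_p(T^*S^* )$ for a certain (and also for all) $\lambda\in\mathbb{R}$, $\lambda\neq0$.
   Context: Hilbert spaces are over the same scalar field, $\mathbb{R}$ or $\mathbb{C}$. A linear operator $S$ acting between $\mathcal{H}$ and $\mathcal{K}$ is a linear map $S:\operatorname{dom}S\to\mathcal{K}$ defined on a linear subspace $\operatorname{dom}S\subseteq\mathcal{H}$ (possibly unbounded). $S$ is closable if the closure of its graph is the graph of an operator, denoted $\bar S$. Equality of operators includes equality of domains. The adjoint $S^*$ of a densely defined $S$ has domain $\{k\in\mathcal{K}:\exists h'\in\mathcal{H}\ \forall h\in\operatorname{dom}S,\ \langle Sh,k\rangle=\langle h,h'\rangle\}$ and $S^*k:=h'$. Products have natural domains: $\operatorname{dom}(S^*T^* )=\{h\in\operatorname{dom}T^*:T^*h\in\operatorname{dom}S^*\}$, and similarly for $T^*S^*$. $S\wedge T$ means $\langle Sh,k\rangle=\langle h,Tk\rangle$ for all $h\in\operatorname{dom}S$, $k\in\operatorname{dom}T$. $\sigma_p(A)$ denotes the point spectrum (set of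 eigenvalues) of an operator $A$: $\mu\in\sigma_p(A)$ iff there is a nonzero $h\in\operatorname{dom}A$ with $Ah=\mu h$. ''For a certain (and also for all) $\lambda$'' means: the statement with ''for some $\lambda$'' and the statement with ''for all $\lambda$'' are both equivalent to the other listed statements. *)

(* Defs.v *)
From HB Require Import structures.
From mathcomp Require Import all_boot all_order all_algebra.
From mathcomp Require Import complex.
From mathcomp Require Import boolp classical_sets functions reals topology normedtype.

Set Implicit Arguments.
Unset Strict Implicit.
Unset Printing Implicit Defensive.

Import Order.TTheory GRing.Theory Num.Theory.
Import numFieldNormedType.Exports.

Local Open Scope classical_set_scope.
Local Open Scope ring_scope.

Variant scalars := RealScalars | ComplexScalars.

Definition scalar_field (R : realType) (s : scalars) : numFieldType :=
  match s with
  | RealScalars => R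
  | ComplexScalars => R[i]
  end.

Definition scalar_conj (R : realType) (s : scalars) :
    involutive_rmorphism (scalar_field R s) :=
  match s with
  | RealScalars => @idfun R
  | ComplexScalars => @Num.conj R[i]
  end.

Definition of_real (R : realType) (s : scalars) :
    {rmorphism R -> scalar_field R s} :=
  match s with
  | RealScalars => @idfun R
  | ComplexScalars => real_complex R
  end.

(* [{dot H for theta}] is linear in its first argument and theta-semilinear
   in its second one. *)
HB.mixin Record CompleteNormedModule_isHilbert (R : realType) (s : scalars) H
    of CompleteNormedModule (scalar_field R s) H := {
  inner : {dot H for scalar_conj R s} ;
  sqr_norm_inner : forall x : H, `|x| ^+ 2 = inner x x
}.

#[short(type="hilbertType")]
HB.structure Definition Hilbert (R : realType) (s : scalars) :=
  {H of CompleteNormedModule (scalar_field R s) H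
      & CompleteNormedModule_isHilbert R s H}.

Notation "''[' x , y ]" := (inner x y) : ring_scope.

(* The values of [fn] outside [dom] are irrelevant. *)
Record operator (R : realType) (s : scalars) (H K : hilbertType R s) := Operator {
  dom : set H ;
  fn :> H -> K ;
  dom0 : dom 0 ;
  domP : forall (a : scalar_field R s) (x y : H),
    dom x -> dom y -> dom (a *: x + y) ;
  fnP : forall (a : scalar_field R s) (x y : H),
    dom x -> dom y -> fn (a *: x + y) = a *: fn x + fn y
}.

Section Operators.
Variables (R : realType) (s : scalars).
Implicit Types H K L : hilbertType R s.

Definition op_eq H K (A B : operator H K) : Prop :=
  dom A = dom B /\ forall x, dom A x -> A x = B x.

Definition graph H K (A : operator H K) : set (H * K) :=
  [set p | dom A p.1 /\ A p.1 = p.2].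

Definition closable H K (A : operator H K) : Prop :=
  exists B : operator H K, graph B = closure (graph A).

Definition op_closure H K (A : operator H K) (cA : closable A) : operator H K :=
  projT1 (cid cA).

Definition densely_defined H K (A : operator H K) : Prop := dense (dom A).

Lemma dense_inner_eq0 H (D : set H) (x : H) : dense D ->
  (forall h, D h -> '[h, x] = 0) -> x = 0.
Proof.
move=> dD hx; apply/eqP/negPn/negP => x0.
have nx0 : 0 < `|x| by rewrite normr_gt0.
have [|y [yx Dy]] := dD (ball x `|x|) _ (ball_open x `|x|).
  by exists x; exact: ballxx.
move: yx; rewrite -ball_normE /ball_/=; apply/negP; rewrite le_gtF//.
rewrite -(@ler_pXn2r _ 2) ?nnegrE// !sqr_norm_inner.
have h2 : '[x, y] = 0.
  have -> : '[x, y] = (-1) ^+ false * scalar_conj R s '[y, x].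
    exact: hermitian_subproof.
  by rewrite hx // rmorph0 mulr0.
rewrite linearBl !linearBr /= h2 (hx _ Dy) subr0 sub0r opprK lerDl.
by rewrite -sqr_norm_inner exprn_ge0.
Qed.

(* [xs] is a value of the adjoint of [A] at [y]. *)
Definition adjoint_at H K (A : operator H K) (y : K) (xs : H) : Prop :=
  forall x, dom A x -> '[A x, y] = '[x, xs].

Section Adjoint.
Variables (H K : hilbertType R s) (A : operator H K).
Hypothesis dA : densely_defined A.

Lemma adjoint_at_uniq y u v :
  adjoint_at A y u -> adjoint_at A y v -> u = v.
Proof.
move=> yu yv; apply/eqP; rewrite -subr_eq0; apply/eqP.
apply: (dense_inner_eq0 dA) => h Ah.
by rewrite linearBr /= -yu // -yv // subrr.
Qed.

Lemma adjoint_atP a y z u v : adjoint_at A y u -> adjoint_at A z v ->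
  adjoint_at A (a *: y + z) (a *: u + v).
Proof.
by move=> yu zv x Ax; rewrite !linearPr /= yu // zv.
Qed.

Definition adjoint_dom : set K := [set y | exists xs, adjoint_at A y xs].

Definition adjoint_fn (y : K) : H := xget 0 [set xs | adjoint_at A y xs].

Lemma adjoint_fnE y xs : adjoint_at A y xs -> adjoint_fn y = xs.
Proof.
move=> yxs; apply: (adjoint_at_uniq _ yxs).
by rewrite /adjoint_fn; case: xgetP => [? _ //|/(_ xs) /(_ yxs)].
Qed.

Lemma adjoint_dom0 : adjoint_dom 0.
Proof. by exists 0 => x _; rewrite !linear0r. Qed.

Lemma adjoint_domP a y z :
  adjoint_dom y -> adjoint_dom z -> adjoint_dom (a *: y + z).
Proof. by move=> [u yu] [v zv]; exists (a *: u + v); exact: adjoint_atP. Qed.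

Lemma adjoint_fnP a y z : adjoint_dom y -> adjoint_dom z ->
  adjoint_fn (a *: y + z) = a *: adjoint_fn y + adjoint_fn z.
Proof.
move=> [u yu] [v zv]; rewrite (adjoint_fnE yu) (adjoint_fnE zv).
exact/adjoint_fnE/adjoint_atP.
Qed.

Definition adjoint : operator K H :=
  Operator adjoint_dom0 adjoint_domP adjoint_fnP.

End Adjoint.

Section Composition.
Variables (H K L : hilbertType R s) (A : operator K L) (B : operator H K).

Definition comp_dom : set H := [set x | dom B x /\ dom A (B x)].

Lemma fn0 : B 0 = 0.
Proof.
have := fnP 1 (dom0 B) (dom0 B).
by rewrite !scale1r addr0 => /eqP; rewrite addrC -subr_eq subrr => /eqP.
Qed.

Lemma comp_dom0 : comp_dom 0.
Proof. by split; [exact: dom0 | rewrite fn0; exact: dom0]. Qed.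

Lemma comp_domP a x y : comp_dom x -> comp_dom y -> comp_dom (a *: x + y).
Proof.
by move=> [Bx Ax] [By Ay]; split; [exact: domP | rewrite fnP//; exact: domP].
Qed.

Lemma comp_fnP a x y : comp_dom x -> comp_dom y ->
  A (B (a *: x + y)) = a *: A (B x) + A (B y).
Proof. by move=> [Bx Ax] [By Ay]; rewrite fnP// fnP. Qed.

Definition op_comp : operator H L :=
  @Operator _ _ _ _ _ (A \o B) comp_dom0 comp_domP comp_fnP.

End Composition.

Definition point_spectrum H (A : operator H H) : set (scalar_field R s) :=
  [set mu | exists2 x, x != 0 & dom A x /\ A x = mu *: x].

(* The relation written S /\ T (wedge) in the literature. *)
Definition formal_adjoints H K (S : operator H K) (T : operator K H) : Prop :=
  forall x y, dom S x -> dom T y -> '[S x, y] = '[x, T y].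

End Operators.

(* Main.v *)
Require Import Defs.
From HB Require Import structures.
From mathcomp Require Import all_boot all_order all_algebra.
From mathcomp Require Import complex ring.
From mathcomp Require Import boolp classical_sets reals interval_inference.
From mathcomp Require Import topology normedtype.

Set Implicit Arguments.
Unset Strict Implicit.
Unset Printing Implicit Defensive.

Import Order.TTheory GRing.Theory Num.Theory.
Import numFieldNormedType.Exports.
Local Open Scope classical_set_scope.
Local Open Scope ring_scope.

(** Everything turns on the graph of S: clause (i) says that the graph of the
adjoint T* is the closure of the graph of S, and S /\ T says that the graph of
T* contains the graph of S. As the graph of an adjoint is closed, S /\ T makes
it contain the closure too, so the remaining question is whether a point of the
graph of T* can lie off that closure.

Suppose p does. Put on H x K the weighted inner product
c <x, x'> + <y, y'> with c = lambda^2, and project p onto the closure of the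
graph of S (approx_projection): this gives a nonzero (x, T* x) orthogonal to
the graph of S, that is
<S h, T* x> = <h, - lambda^2 x> for all h in dom S. Hence T* x is in dom S* and
S* T* x = - lambda^2 x, and x is nonzero, so - lambda^2 is an eigenvalue of
S* T* (graph_adjoint_eq_closure). The vector T* x is then an eigenvector of
T* S* for the same eigenvalue (point_spectrum_comp_swap), so either of the
spectral hypotheses, for a single lambda, gives (i).

Conversely, if the graph of T* is the closure of the graph of S, then
<T* x, k> = <x, S* k> for x in dom T* and k in dom S*, since this holds on the
graph of S and is preserved by limits (closure_graph_inner). With k = T* x, or
with x = S* k, an eigenvector v for - lambda^2 would give
0 <= |w|^2 = - lambda^2 |v|^2 for some w, whence v = 0, for every nonzero
lambda. *)

(** * Scalars *)

Section Scalars.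
Variables (R : realType) (s : scalars).
Local Notation F := (scalar_field R s).

Lemma mul_scalar_conj (x : F) : x * scalar_conj R s x = `|x| ^+ 2.
Proof. by case: s x => x /=; [rewrite real_normK ?num_real|rewrite normCK]. Qed.

Lemma scalar_conj_ge0 (x : F) : 0 <= x -> scalar_conj R s x = x.
Proof. by case: s x => x //= x0; exact: geC0_conj. Qed.

Lemma ler_of_real (x y : R) : (of_real R s x <= of_real R s y) = (x <= y).
Proof. by case: s => //=; exact: lecR. Qed.

Lemma ge0_of_real (x : F) : 0 <= x -> exists r : R, x = of_real R s r.
Proof.
case: s x => x /= x0; first by exists x.
by exists (complex.Re x); rewrite /= RRe_real// ger0_real.
Qed.

(** The order on complex scalars is only partial, so that infima do not exist in
general; nonnegative scalars, however, are real, and their infimum can be taken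
in R. *)
Lemma ge0_inf (E : set F) : E !=set0 -> (forall x, E x -> 0 <= x) ->
  exists d : F, (forall x, E x -> d <= x) /\
    forall e, 0 < e -> exists2 x, E x & x < d + e.
Proof.
move=> [x0 Ex0] E0; pose E' := [set r : R | E (of_real R s r)].
have E'inf : has_inf E'.
  split.
    by have [r rx0] := ge0_of_real (E0 _ Ex0); exists r; rewrite /E' /= -rx0.
  by exists 0 => r /E0; rewrite -[X in X <= _](rmorph0 (of_real R s)) ler_of_real.
exists (of_real R s (inf E')); split=> [x Ex|e e0].
  have [r rx] := ge0_of_real (E0 _ Ex).
  by rewrite rx ler_of_real; apply: ge_inf; [case: E'inf|rewrite /E' /= -rx].
have [r rE] := ge0_of_real (ltW e0).
have r0 : 0 < r.
  move: e0; rewrite rE -[X in X < _](rmorph0 (of_real R s)) !lt_neqAle.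
  by rewrite ler_of_real => /andP[ne ->]; rewrite andbT; apply: contra ne => /eqP ->.
have [t Et tr] := inf_adherent r0 E'inf; exists (of_real R s t) => //.
rewrite rE -rmorphD lt_neqAle ler_of_real (ltW tr) andbT.
by rewrite (inj_eq (fmorph_inj _)) (lt_eqF tr).
Qed.

Lemma scalar_of_real (r : R) : scalar_conj R s (of_real R s r) = of_real R s r.
Proof.
wlog r0 : r / 0 <= r => [hyp|].
  have [/hyp//|/ltW r0] := leP 0 r.
  by apply: oppr_inj; rewrite -!rmorphN /= hyp// oppr_ge0.
by rewrite scalar_conj_ge0// -[X in X <= _](rmorph0 (of_real R s)) ler_of_real.
Qed.

Lemma of_real_sqr_gt0 (lam : R) : lam != 0 -> 0 < of_real R s lam ^+ 2.
Proof.
move=> l0; rewrite -rmorphXn /= lt_neqAle -{2}(rmorph0 (of_real R s)) ler_of_real.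
by rewrite sqr_ge0 andbT eq_sym fmorph_eq0 sqrf_eq0.
Qed.

End Scalars.

(** Numerical fields need not have square roots; this replaces the square root of
e as a threshold on distances. *)
Lemma small_sqr (F : numFieldType) (e : F) : 0 < e ->
  exists2 d, 0 < d & d ^+ 2 < e.
Proof.
move=> e0; have e1 : 0 < 1 + e by rewrite addr_gt0.
exists (e / (1 + e)); first by rewrite divr_gt0.
rewrite expr_div_n ltr_pdivrMr ?exprn_gt0// expr2 ltr_pM2l// -subr_gt0.
have -> : (1 + e) ^+ 2 - e = 1 + e + e ^+ 2 by ring.
by rewrite !addr_gt0 ?exprn_gt0.
Qed.

(** * Orthogonal projection in an inner product space *)

Section Projection.
Variables (R : realType) (s : scalars) (V : lmodType (scalar_field R s)).
Variable B : {dot V for scalar_conj R s}.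
Local Notation q v := (B v v).

Lemma dotC u v : B u v = scalar_conj R s (B v u).
Proof. by rewrite hermC expr0 mul1r. Qed.

Lemma dotZl a u v : B (a *: u) v = a * B u v.
Proof. exact: linearZl_LR. Qed.

Lemma dotZr a u v : B u (a *: v) = scalar_conj R s a * B u v.
Proof. exact: linearZr_LR. Qed.

Lemma dotB u v :
  q (u - v) = q u + q v - (B u v + scalar_conj R s (B u v)).
Proof. by rewrite hnormB expr0 mul1r. Qed.

Lemma dot_ge0 v : 0 <= q v.
Proof.
have [->|v0] := eqVneq v 0; first by rewrite linear0l.
by apply/ltW/neq0_dnorm_gt0.
Qed.

Lemma normr_dotC u v : `|B u v| = `|B v u|.
Proof.
apply/eqP; rewrite -(@eqrXn2 _ 2)// -!mul_scalar_conj -!dotC.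
by rewrite mulrC.
Qed.

(** Subtracting from w its component along n, namely a n with
a = B w n / B n n, lowers B w w by |B w n|^2 / B n n. Hence if w has almost the least
squared length d on the line through w with direction n, then w is almost
orthogonal to n; when d = 0 this is the Cauchy-Schwarz inequality. *)
Lemma dot_distance_bound d w n : (forall a, d <= q (w - a *: n)) ->
  `|B w n| ^+ 2 <= (q w - d) * q n.
Proof.
have [->|n0] := eqVneq n 0.
  by move=> _; rewrite !linear0r normr0 expr0n mulr0.
have qn0 : 0 < q n by exact: neq0_dnorm_gt0.
move=> /(_ (B w n / q n)); set a := B w n / q n.
have tn : scalar_conj R s (q n)^-1 = (q n)^-1.
  by rewrite scalar_conj_ge0// invr_ge0 ltW.
have awn : scalar_conj R s a * B w n = `|B w n| ^+ 2 / q n.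
  by rewrite rmorphM /= tn -mul_scalar_conj mulrAC; congr (_ / _); exact: mulrC.
have b0 : 0 <= `|B w n| ^+ 2 / q n by rewrite divr_ge0 ?exprn_ge0// ltW.
rewrite dotB dotZl !dotZr awn (scalar_conj_ge0 b0).
have -> : a * (scalar_conj R s a * q n) = `|B w n| ^+ 2 / q n.
  by rewrite mulrCA /a divfK ?gt_eqF.
rewrite opprD addrA addrK lerBrDr -lerBrDl => h.
by rewrite -ler_pdivrMr.
Qed.

Lemma dot_CauchySchwarz u v : `|B u v| ^+ 2 <= q u * q v.
Proof.
by rewrite -[q u]subr0; apply: dot_distance_bound => a; exact: dot_ge0.
Qed.

Lemma dot_parallelogram u v : q (u + v) + q (u - v) = q u *+ 2 + q v *+ 2.
Proof. by rewrite hnormD hnormB addrACA subrr addr0 -mulr2n mulrnDl. Qed.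

(** Completeness for the norm of B, stated with Cauchy filters so that no topology
on V has to be attached to B. *)
Definition dot_complete := forall F : set_system V, ProperFilter F ->
  (forall e, 0 < e -> exists2 A, F A & forall x y, A x -> A y -> q (x - y) < e) ->
  exists l, forall e, 0 < e -> F [set x | q (x - l) < e].

(** The projection theorem for the closure of a subspace M, with m the projection
of p. By the parallelogram identity the
points of M whose squared distance to p is close to the infimum d form a Cauchy
filter, and m is the limit of that filter. Orthogonality is read off a nearby y in M: both
B (p - y) x and B (y - m) x are small by dot_distance_bound. *)
Lemma approx_projection (M : set V) (p : V) : dot_complete ->
  M 0 -> (forall a x y, M x -> M y -> M (a *: x + y)) ->
  exists m, (forall e, 0 < e -> exists2 x, M x & q (x - m) < e) /\
    forall x, M x -> B x (p - m) = 0.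
Proof.
move=> cB M0 MP.
have [||d [dle dinf]] := @ge0_inf R s [set q (p - x) | x in M].
- by exists (q (p - 0)), 0.
- by move=> _ [x _ <-]; exact: dot_ge0.
have MZ a x : M x -> M (a *: x) by move=> Mx; rewrite -[a *: x]addr0; exact: MP.
have MD x y : M x -> M y -> M (x + y).
  by move=> Mx My; rewrite -[x]scale1r; exact: MP.
pose near_opt (e : scalar_field R s) := [set x | M x /\ q (p - x) < d + e].
pose F := filter_from [set e | 0 < e] near_opt.
have FF : ProperFilter F.
  apply: filter_from_proper => [|e e0]; last first.
    by have [_ [x Mx <-] xe] := dinf _ e0; exists x.
  apply: filter_from_filter; first by exists 1; rewrite /= ltr01.
  have le_near e e' : e <= e' -> near_opt e `<=` near_opt e'.
    by move=> ee' x [Mx xe]; split=> //; apply: (lt_le_trans xe); rewrite lerD2l.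
  move=> e e' e0 e'0.
  have /orP[ee'|ee'] := real_leVge (gtr0_real e0) (gtr0_real e'0).
    by exists e => // x xe; split=> //; exact: le_near xe.
  by exists e' => // x xe; split=> //; exact: le_near xe.
have [e e0|m mlim] := cB F FF.
  exists (near_opt (e / 4)); first by exists (e / 4) => //=; rewrite divr_gt0.
  move=> x y [Mx xe] [My ye].
  (* The midpoint of x and y lies in M, so d bounds its distance to p. *)
  have : d *+ 4 <= q ((p - x) + (p - y)).
    have Mxy : M (2^-1 *: (x + y)) by apply/MZ/MD.
    have -> : (p - x) + (p - y) = 2 *: (p - 2^-1 *: (x + y)).
      rewrite scalerBr scalerA divff ?pnatr_eq0// scale1r scaler_nat mulr2n.
      by rewrite opprD addrACA.
    rewrite dotZl dotZr scalar_conj_ge0// mulrA -natrM.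
    by rewrite -[_ *+ 4]mulr_natl ler_pM2l//; apply: dle; exists (2^-1 *: (x + y)).
  have := dot_parallelogram (p - x) (p - y).
  have -> : (p - x) - (p - y) = y - x by rewrite opprB addrC subrKA.
  rewrite -(hnormN B (y - x)) opprB => pE.
  have : (q (p - x) + q (p - y)) *+ 2 < (d + e / 4 + (d + e / 4)) *+ 2.
    by rewrite ltrMn2r /= ltrD.
  rewrite mulrnDl -pE -mulr2n -mulrnA mulrnDl -[(e / 4) *+ _]mulr_natr.
  rewrite divfK ?pnatr_eq0//.
  move=> h1 h2.
  by rewrite -(ltrD2l (d *+ 4)); apply: le_lt_trans h1; rewrite lerD2r.
exists m; split=> [e e0|x Mx].
  have [e' e'0 sub] := mlim e e0.
  have [_ [x Mx <-] xe] := dinf _ e'0; exists x => //.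
  by apply: sub; split.
apply/eqP; rewrite -normr_eq0 normr_dotC -sqrf_eq0 eq_le exprn_ge0 // andbT.
apply/ler_addgt0Pl => e e0; rewrite addr0.
(* The two bounds below add up to at most 4 e' q x <= e. *)
pose e' := e / (1 + q x) / 4.
have qx1 : 0 < 1 + q x by rewrite ltr_pwDl ?dot_ge0.
have e'0 : 0 < e' by rewrite !divr_gt0.
have : F ([set y | q (y - m) < e'] `&` near_opt e').
  by apply: filterI; [exact: mlim|exists e'].
move=> /filter_ex[y [/ltW ym [My /ltW yp]]].
have h1 : `|B (p - y) x| ^+ 2 <= e' * q x.
  apply: le_trans (_ : (q (p - y) - d) * q x <= _).
    apply: dot_distance_bound => a; apply: dle; exists (a *: x + y); first exact: MP.
    by rewrite opprD addrA addrAC.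
  by rewrite ler_wpM2r ?dot_ge0// lerBlDl.
have h2 : `|B (y - m) x| ^+ 2 <= e' * q x.
  by apply: le_trans (dot_CauchySchwarz _ _) _; rewrite ler_wpM2r ?dot_ge0.
have -> : p - m = (p - y) + (y - m) by rewrite addrA subrK.
rewrite linearDl; set u := B _ x in h1 *; set v := B _ x in h2 *.
have h3 : `|u + v| ^+ 2 <= (`|u| ^+ 2 + `|v| ^+ 2) *+ 2.
  apply: le_trans (_ : (`|u| + `|v|) ^+ 2 <= _).
    by rewrite lerXn2r ?nnegrE ?addr_ge0 ?ler_normD.
  rewrite sqrrD -subr_ge0.
  have -> : (`|u| ^+ 2 + `|v| ^+ 2) *+ 2 - (`|u| ^+ 2 + `|u| * `|v| *+ 2 + `|v| ^+ 2)
     = (`|u| - `|v|) ^+ 2 by rewrite sqrrB mulr2n; ring.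
  by rewrite real_exprn_even_ge0// rpredB ?normr_real.
apply: (le_trans h3).
apply: le_trans (_ : (e' * q x + e' * q x) *+ 2 <= _).
  by rewrite lerMn2r /= lerD.
have -> : (e' * q x + e' * q x) *+ 2 = e * (q x / (1 + q x)).
  rewrite -mulr2n -mulrnA -mulr_natr mulrAC divfK ?pnatr_eq0//.
  by rewrite mulrAC mulrA.
by rewrite ler_piMr ?(ltW e0)// ler_pdivrMr// mul1r lerDr ler01.
Qed.

End Projection.

(** * The product space H x K *)

Section GraphForm.
Variables (R : realType) (s : scalars) (H K : hilbertType R s).
Local Notation F := (scalar_field R s).

(** The weight makes orthogonality to a graph produce the eigenvalue - c for an
arbitrary c > 0 without rescaling the operator. *)
Definition weighted_inner (c : {posnum F}) (p r : H * K) : F :=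
  c%:num * '[p.1, r.1] + '[p.2, r.2].

Section Dot.
Variable c : {posnum F}.

Let weighted_inner_bilinear :
  bilinear_for ( *%R : GRing.Scale.law F F) (scalar_conj R s \; *%R)
    (weighted_inner c).
Proof.
split=> p a x y; rewrite /weighted_inner /=.
  by rewrite !linearPl /=; ring.
by rewrite !linearPr /=; ring.
Qed.

HB.instance Definition _ := bilinear_isBilinear.Build F (H * K)%type (H * K)%type
  F _ _ (weighted_inner c) weighted_inner_bilinear.

Let weighted_inner_sym (p r : H * K) : weighted_inner c p r =
  (-1) ^+ false * scalar_conj R s (weighted_inner c r p).
Proof.
rewrite expr0 mul1r /weighted_inner rmorphD rmorphM /= (scalar_conj_ge0 (ltW _))//.
by rewrite -!dotC.
Qed.

HB.instance Definition _ := isHermitianSesquilinear.Build F (H * K)%type false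
  (scalar_conj R s) (weighted_inner c) weighted_inner_sym.

Let weighted_inner_gt0 (p : H * K) : p != 0 -> 0 < weighted_inner c p p.
Proof.
case: p => x y; rewrite /weighted_inner /= => p0.
have [x0|x0] := eqVneq x 0; last first.
  by rewrite ltr_pwDl ?dot_ge0// mulr_gt0// neq0_dnorm_gt0.
have y0 : y != 0 by apply: contra p0 => /eqP ->; rewrite x0.
by rewrite x0 linear0l mulr0 add0r neq0_dnorm_gt0.
Qed.

HB.instance Definition _ := isDotProduct.Build F (H * K)%type
  (weighted_inner c) weighted_inner_gt0.

End Dot.

Lemma weighted_inner_sqr c (p : H * K) :
  weighted_inner c p p = c%:num * `|p.1| ^+ 2 + `|p.2| ^+ 2.
Proof. by rewrite !sqr_norm_inner. Qed.

(** The factor c / (1 + c) lies below both c and 1, the weights of the two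
components. *)
Lemma weighted_inner_lt (c : {posnum F}) (e : F) (p : H * K) : 0 < e ->
  weighted_inner c p p < c%:num / (1 + c%:num) * e ^+ 2 ->
  `|p.1| < e /\ `|p.2| < e.
Proof.
move=> e0; rewrite weighted_inner_sqr => pe.
have c0 : 0 < c%:num :> F by [].
have c1 : 0 < 1 + c%:num :> F by rewrite addr_gt0.
rewrite -!(@ltr_pXn2r _ 2 _ _ e) ?nnegrE ?(ltW e0)//; split.
  rewrite -(ltr_pM2l c0).
  apply: (@le_lt_trans _ _ (c%:num * `|p.1| ^+ 2 + `|p.2| ^+ 2)).
    by rewrite lerDl exprn_ge0.
  apply: (lt_le_trans pe); rewrite -mulrA ler_pM2l// ler_pdivrMl//.
  by rewrite mulrDl mul1r lerDl mulr_ge0 ?exprn_ge0// ltW.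
apply: (@le_lt_trans _ _ (c%:num * `|p.1| ^+ 2 + `|p.2| ^+ 2)).
  by rewrite lerDr mulr_ge0 ?exprn_ge0// ltW.
apply: (lt_le_trans pe); rewrite ler_piMl ?exprn_ge0 ?(ltW e0)//.
by rewrite ler_pdivrMr// mul1r lerDr ler01.
Qed.

(** The weighted norm induces the product uniformity, so completeness is inherited
componentwise from H and K. *)
Lemma weighted_inner_complete (c : {posnum F}) :
  dot_complete (weighted_inner c : {dot (H * K)%type for scalar_conj R s}).
Proof.
move=> G GG Gcauchy.
have c0 : 0 < c%:num :> F by [].
have [/cvg_ex[u Gu] /cvg_ex[v Gv]] : cvg (fst @ G) /\ cvg (snd @ G).
  have Gball e : 0 < e -> exists p, G (fst @^-1` ball p.1 e) /\
      G (snd @^-1` ball p.2 e).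
    move=> e0; have [|A GA Ae] := Gcauchy (c%:num / (1 + c%:num) * e ^+ 2).
      by rewrite mulr_gt0 ?exprn_gt0 ?divr_gt0 ?addr_gt0.
    have [p Ap] := filter_ex GA; exists p.
    by split; apply: filterS GA => r /(Ae _ _ Ap) /(weighted_inner_lt e0)[];
       rewrite -ball_normE.
  split; apply: cauchy_cvg; apply: cauchy_exP => e /Gball[p [Gp1 Gp2]].
    by exists p.1.
  by exists p.2.
exists (u, v) => e e0.
have [d1 d10 d1e] : exists2 d, 0 < d & d ^+ 2 < e / 2 / c%:num.
  by apply: small_sqr; rewrite !divr_gt0.
have [d2 d20 d2e] : exists2 d, 0 < d & d ^+ 2 < e / 2.
  by apply: small_sqr; rewrite divr_gt0.
have G1 : G [set p | `|u - p.1| < d1] by move/cvgrPdist_lt: Gu; exact.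
have G2 : G [set p | `|v - p.2| < d2] by move/cvgrPdist_lt: Gv; exact.
apply: filterS (filterI G1 G2) => p [/= p1 p2].
rewrite /= weighted_inner_sqr /= distrC [`|p.2 - v|]distrC [e]splitr ltrD//.
  rewrite -ltr_pdivlMl// mulrC; apply: le_lt_trans d1e.
  by rewrite ler_pXn2r ?nnegrE ?(ltW d10) ?(ltW p1).
by apply: le_lt_trans d2e; rewrite ler_pXn2r ?nnegrE ?(ltW d20) ?(ltW p2).
Qed.

Lemma closure_prodP (A : set (H * K)) p : closure A p <->
  forall e, 0 < e -> exists2 r, A r & `|p.1 - r.1| < e /\ `|p.2 - r.2| < e.
Proof.
split=> [Ap e e0|Ap U].
  have [|r [Ar [r1 r2]]] := Ap (ball p e); first exact: nbhsx_ballx.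
  by exists r => //; move: r1 r2; rewrite -!ball_normE.
move=> /nbhs_ballP[e /= e0 eU]; have [r Ar [r1 r2]] := Ap e e0.
by exists r; split=> //; apply: eU; split; rewrite -ball_normE.
Qed.

Lemma closure_weighted_inner (c : {posnum F}) (A : set (H * K)) m :
  (forall e, 0 < e -> exists2 r, A r & weighted_inner c (r - m) (r - m) < e) ->
  closure A m.
Proof.
move=> Am; apply/closure_prodP => e e0.
have [|r Ar /(weighted_inner_lt e0)[r1 r2]] := Am (c%:num / (1 + c%:num) * e ^+ 2).
  by rewrite mulr_gt0 ?exprn_gt0 ?divr_gt0 ?addr_gt0.
by exists r; rewrite // distrC [`|m.2 - _|]distrC.
Qed.

Lemma normr_inner (L : hilbertType R s) (x y : L) : `|'[x, y]| <= `|x| * `|y|.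
Proof.
rewrite -(@ler_pXn2r _ 2) ?nnegrE ?mulr_ge0// exprMn !sqr_norm_inner.
exact: dot_CauchySchwarz.
Qed.

(** Both sides are continuous in p by Cauchy-Schwarz. Adjoints are defined by
identities of this form, so they extend to closures of graphs. *)
Lemma closure_inner_eq (A : set (H * K)) (a : H) (b : K) :
  (forall p, A p -> '[p.1, a] = '[p.2, b]) ->
  forall p, closure A p -> '[p.1, a] = '[p.2, b].
Proof.
move=> Aab p /closure_prodP Ap; apply/eqP; rewrite -subr_eq0 -normr_le0.
apply/ler_addgt0Pl => e e0; rewrite addr0.
have C0 : 0 < 1 + (`|a| + `|b|) by rewrite ltr_pwDl ?addr_ge0.
have [|r Ar [r1 r2]] := Ap (e / (1 + (`|a| + `|b|))); first by rewrite divr_gt0.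
have -> : '[p.1, a] - '[p.2, b] = '[p.1 - r.1, a] - '[p.2 - r.2, b].
  by rewrite !linearBl /= (Aab _ Ar) opprB addrA subrK.
apply: le_trans (ler_normB _ _) _.
apply: le_trans (_ : e / (1 + (`|a| + `|b|)) * (`|a| + `|b|) <= _).
  rewrite mulrDr lerD//; apply: le_trans (normr_inner _ _) _;
    by rewrite ler_wpM2r// ltW.
by rewrite mulrAC ler_pdivrMr// ler_pM2l// lerDr.
Qed.

End GraphForm.

(** * The graph of the adjoint and the closure of the graph of S *)

Section ClosureAdjoint.
Variables (R : realType) (s : scalars) (H K : hilbertType R s).
Variables (S : operator H K) (T : operator K H).
Hypotheses (dS : densely_defined S) (dT : densely_defined T).
Local Notation F := (scalar_field R s).

Lemma graph_adjointP (p : H * K) :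
  graph (adjoint dT) p <-> forall k, dom T k -> '[p.1, T k] = '[p.2, k].
Proof.
case: p => x y; split=> /= [[[xs Txs] /= <-] k Tk|Tp].
  rewrite dotC [RHS]dotC (adjoint_fnE dT Txs).
  by rewrite Txs.
have Tp' : adjoint_at T x y by move=> k Tk; rewrite dotC Tp// -dotC.
by split; [exists y|exact: adjoint_fnE].
Qed.

Lemma closed_graph_adjoint : closure (graph (adjoint dT)) `<=` graph (adjoint dT).
Proof.
move=> p Tp; apply/graph_adjointP => k Tk; apply: closure_inner_eq Tp => r.
by move=> /graph_adjointP; exact.
Qed.

Lemma formal_adjoints_graphP :
  formal_adjoints S T <-> graph S `<=` graph (adjoint dT).
Proof.
split=> [ST [x y] [/= Sx <-]|ST x y Sx Ty].
  by apply/graph_adjointP => k Tk; rewrite ST.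
by have /graph_adjointP/(_ y Ty) /= : graph (adjoint dT) (x, S x) by exact: ST.
Qed.

(** Closability comes for free from the equality of graphs, as T* is then itself
the operator whose graph is the closure. *)
Lemma op_closure_adjointP :
  (exists cS : closable S, op_eq (op_closure cS) (adjoint dT)) <->
  graph (adjoint dT) = closure (graph S).
Proof.
split=> [[cS [domE fnE]]|gT].
  rewrite -(projT2 (cid cS)) -/(op_closure cS).
  apply/seteqP; split=> -[x y] [Dx xy].
    by split; [rewrite domE|rewrite fnE ?domE].
  by split; [rewrite -domE|rewrite -fnE].
have cS : closable S by exists (adjoint dT).
exists cS; have : graph (op_closure cS) = graph (adjoint dT).
  by rewrite gT -(projT2 (cid cS)).
move=> gE; have sub x : dom (op_closure cS) x ->
    dom (adjoint dT) x /\ adjoint dT x = op_closure cS x.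
  by move=> Dx; have : graph (adjoint dT) (x, op_closure cS x) by rewrite -gE.
split=> [|x /sub[_ ->]//]; apply/seteqP; split=> x; first by case/sub.
move=> Dx; have : graph (op_closure cS) (x, adjoint dT x) by rewrite gE.
by case.
Qed.

(** An eigenvector x for - lam^2 leads to this identity, which the positivity of
inner products rules out unless x = 0. *)
Lemma dot_neg_eq (L L' : hilbertType R s) (lam : R) (x : L) (y : L') : lam != 0 ->
  '[y, y] = - of_real R s lam ^+ 2 * '[x, x] -> x = 0.
Proof.
move=> l0 xy; apply/eqP; apply: contraT => x0.
have xx0 : 0 < of_real R s lam ^+ 2 * '[x, x].
  by rewrite mulr_gt0 ?of_real_sqr_gt0// neq0_dnorm_gt0.
have := dot_ge0 inner y.
by rewrite xy mulNr oppr_ge0 => /(lt_le_trans xx0); rewrite ltxx.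
Qed.

Lemma closure_graph_inner p k : closure (graph S) p -> dom (adjoint dS) k ->
  '[p.1, adjoint dS k] = '[p.2, k].
Proof.
move=> Sp [xs Sxs]; apply: closure_inner_eq Sp => -[x y] [/= Sx <-].
by rewrite /= (adjoint_fnE dS Sxs) Sxs.
Qed.

Section NoEigenvalue.
Hypothesis gT : graph (adjoint dT) = closure (graph S).
Variables (lam : R).
Hypothesis lam0 : lam != 0.

(** For an eigenvector x, take k = T* x in closure_graph_inner. *)
Lemma not_eigenvalue_SaTa : ~ point_spectrum (op_comp (adjoint dS) (adjoint dT))
               (- of_real R s lam ^+ 2).
Proof.
case=> x x0 [[Tx STx] /= xE]; case/eqP: x0.
have Sx : closure (graph S) (x, adjoint dT x) by rewrite -gT.
have /= := closure_graph_inner Sx STx; rewrite xE dotZr.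
rewrite rmorphN rmorphXn /= scalar_of_real => /esym; exact: dot_neg_eq.
Qed.

(** For an eigenvector y, apply closure_graph_inner to k = y and to the point
(S* y, T* S* y) of the closure. *)
Lemma not_eigenvalue_TaSa : ~ point_spectrum (op_comp (adjoint dT) (adjoint dS))
               (- of_real R s lam ^+ 2).
Proof.
case=> y y0 [[Sy TSy] /= yE]; case/eqP: y0.
have Sx : closure (graph S) (adjoint dS y, adjoint dT (adjoint dS y)).
  by rewrite -gT.
have /= := closure_graph_inner Sx Sy; rewrite yE dotZl; exact: dot_neg_eq.
Qed.

End NoEigenvalue.

Lemma graph_adjointB p r : graph (adjoint dT) p -> graph (adjoint dT) r ->
  graph (adjoint dT) (p - r).
Proof.
move=> /graph_adjointP Tp /graph_adjointP Tr; apply/graph_adjointP => k Tk.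
by rewrite !linearBl /= Tp// Tr.
Qed.

(** The defect p - m of a point p of the graph of T*, where m is its projection
onto the closure of the graph of S, still lies on the graph of T*; were it
nonzero, its first component would be an eigenvector of S* T*. *)
Lemma graph_adjoint_eq_closure (lam : R) : lam != 0 -> formal_adjoints S T ->
  ~ point_spectrum (op_comp (adjoint dS) (adjoint dT)) (- of_real R s lam ^+ 2) ->
  graph (adjoint dT) = closure (graph S).
Proof.
move=> l0 /formal_adjoints_graphP ST nspec.
have cST : closure (graph S) `<=` graph (adjoint dT).
  by apply: subset_trans closed_graph_adjoint; exact: closureS.
apply/seteqP; split=> // p Tp.
pose c : {posnum F} := PosNum (of_real_sqr_gt0 s l0).
have [||m [mclose morth]] := approx_projection p (@weighted_inner_complete _ _ H K c)
    (M := graph S).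
- by split; [exact: dom0|exact: fn0].
- by move=> a [x1 x2] [y1 y2] [/= Sx <-] [/= Sy <-]; split; [exact: domP|exact: fnP].
have Sm := closure_weighted_inner mclose.
have := graph_adjointB Tp (cST _ Sm).
have [/eqP|pm0] := eqVneq (p - m) 0; first by rewrite subr_eq0 => /eqP ->.
move: morth; case: (p - m) pm0 => x y xy0 morth [/= Tx xy].
have Sy : adjoint_at S y (- of_real R s lam ^+ 2 *: x).
  move=> h Sh; rewrite dotZr rmorphN rmorphXn /= scalar_of_real mulNr.
  apply/eqP; rewrite -addr_eq0 addrC; apply/eqP.
  by have /= := morth (h, S h) (conj Sh erefl).
case: nspec; exists x.
  (* The second component is T* x, so x = 0 would make the defect vanish. *)
  apply: contra xy0 => /eqP x0; rewrite -xy x0.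
  by have /= -> := fn0 (adjoint dT).
split; first by split=> //=; rewrite xy; exists (- of_real R s lam ^+ 2 *: x).
by rewrite /= xy; exact: adjoint_fnE.
Qed.

(** As for a product of matrices, T* maps eigenvectors of S* T* to eigenvectors of
T* S*; a nonzero eigenvalue keeps the image nonzero. *)
Lemma point_spectrum_comp_swap (mu : F) : mu != 0 ->
  point_spectrum (op_comp (adjoint dS) (adjoint dT)) mu ->
  point_spectrum (op_comp (adjoint dT) (adjoint dS)) mu.
Proof.
move=> mu0 [x x0 [[Tx STx] STxE]].
have xE : adjoint dS (adjoint dT x) = mu *: x by [].
exists (adjoint dT x).
  apply: contra x0 => /eqP Tx0; move: xE; rewrite Tx0 fn0 => /esym/eqP.
  by rewrite scaler_eq0 (negPf mu0).
have D0 := dom0 (adjoint dT).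
have := fnP mu Tx D0; have := domP mu Tx D0.
rewrite fn0 !addr0 -xE => TSTx TSTxE.
by split; [split|].
Qed.

End ClosureAdjoint.

(** * Equivalence of the clauses *)

Theorem corollary4p7 (R : realType) (s : scalars) (H K : hilbertType R s)
    (S : operator H K) (T : operator K H)
    (dS : densely_defined S) (dT : densely_defined T) :
  [<-> exists cS : closable S, op_eq (op_closure cS) (adjoint dT);
       formal_adjoints S T /\
         exists2 lam : R, lam != 0 &
           ~ point_spectrum (op_comp (adjoint dS) (adjoint dT))
               (- of_real R s lam ^+ 2);
       formal_adjoints S T /\
         forall lam : R, lam != 0 ->
           ~ point_spectrum (op_comp (adjoint dS) (adjoint dT))
               (- of_real R s lam ^+ 2);
       formal_adjoints S T /\
         exists2 lam : R, lam != 0 &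
           ~ point_spectrum (op_comp (adjoint dT) (adjoint dS))
               (- of_real R s lam ^+ 2);
       formal_adjoints S T /\
         forall lam : R, lam != 0 ->
           ~ point_spectrum (op_comp (adjoint dT) (adjoint dS))
               (- of_real R s lam ^+ 2) ].
Proof.
have formal : graph (adjoint dT) = closure (graph S) -> formal_adjoints S T.
  move=> gT; apply/(formal_adjoints_graphP S dT); rewrite gT.
  exact: subset_closure.
tfae.
- move=> /op_closure_adjointP gT; split; first exact: formal.
  by exists 1; [exact: oner_neq0|apply: not_eigenvalue_SaTa => //; exact: oner_neq0].
- move=> [ST [lam l0 /(graph_adjoint_eq_closure l0 ST) gT]]; split=> // mu mu0.
  exact: not_eigenvalue_SaTa.
- move=> [ST nspec]; split=> //; have l1 : (1 : R) != 0 by exact: oner_neq0.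
  exists 1 => //; apply: not_eigenvalue_TaSa => //.
  by apply: (graph_adjoint_eq_closure l1 ST); exact: nspec.
- move=> [ST [lam l0 nspec]]; split=> // mu mu0; apply: not_eigenvalue_TaSa => //.
  apply: (graph_adjoint_eq_closure l0 ST) => spec; apply: nspec.
  apply: point_spectrum_comp_swap spec.
  by rewrite oppr_eq0 gt_eqF ?of_real_sqr_gt0.
- move=> [ST nspec]; apply/op_closure_adjointP.
  have l1 : (1 : R) != 0 by exact: oner_neq0.
  apply: (graph_adjoint_eq_closure l1 ST) => spec; apply: (nspec _ l1).
  apply: point_spectrum_comp_swap spec.
  by rewrite oppr_eq0 gt_eqF ?of_real_sqr_gt0.
Qed.
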